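(* Let $j$ and $n$ be non-negative integers with $j\le n$, and let $\{(s_k),(\sigma_k)\}$, $k=0,1,2,\ldots$, be a binomial-transform pair of the first kind. Then \[ \sum_{k=0}^n(-1)^k\binom{n-j}{k}2^{n-k}s_k=2^j\sum_{k=0}^n\binom{n-j}{k}\sigma_k. \]
   Context: Two sequences $(s_k)_{k\ge0}$ and $(\sigma_k)_{k\ge0}$ of complex numbers form a binomial-transform pair of the first kind if $\sigma_n=\sum_{k=0}^n(-1)^k\binom nk s_k$ for every non-negative integer $n$. $\binom ab=0$ for integers $0\le a<b$. *)

(* Defs.v *)
From mathcomp Require Import all_boot all_order all_algebra.
From mathcomp Require Import reals complex.

Set Implicit Arguments.
Unset Strict Implicit.
Unset Printing Implicit Defensive.

Import GRing.Theory.
Local Open Scope ring_scope.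

(* The complex numbers are R[i] with R a model of the real numbers. *)
Definition binomial_pair1 (R : realType) (s sigma : nat -> R[i]) : Prop :=
  forall n : nat,
    sigma n = \sum_(0 <= k < n.+1) (-1) ^+ k * 'C(n, k)%:R * s k.

(* Main.v *)
Require Import Defs.
From mathcomp Require Import all_boot all_order all_algebra.
From mathcomp Require Import reals complex.
From mathcomp Require Import ring.

Set Implicit Arguments.
Unset Strict Implicit.
Unset Printing Implicit Defensive.

Import GRing.Theory.
Local Open Scope ring_scope.

(** Expand each [sigma k] by the pair relation and exchange the sums: the coefficient of
    [(-1) ^+ i * s i] on the right becomes [2 ^+ j] times the sum over [k] of ['C(m, k) * 'C(k, i)]
    with [m = n - j]. By [sum_bin_mul_bin] that sum is ['C(m, i) * 2 ^ (m - i)], and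
    [j + (m - i) = n - i] gives the left side. The lemma follows by induction on [m] from Pascal's
    rule. *)

Lemma sum_bin_mul_bin (N m i : nat) : (m < N)%N ->
  (\sum_(0 <= k < N) 'C(m, k) * 'C(k, i) = 'C(m, i) * 2 ^ (m - i))%N.
Proof.
elim: m N i => [|m IHm] [|N] i //.
  move=> _; rewrite big_nat_recl // big1 ?addn0 => [|k _]; last by rewrite bin0n.
  by rewrite bin0 mul1n sub0n expn0 muln1.
rewrite ltnS => ltmN; rewrite big_nat_recl // bin0 mul1n.
under eq_bigr => k _ do rewrite binS mulnDl.
have IHmS := IHm N.+1 i (ltnW ltmN : (m < N.+1)%N).
rewrite big_nat_recl // bin0 mul1n in IHmS.
(* The ['C(m, k.+1)] half of Pascal's rule, joined with the [k = 0] term, is the whole sum for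
   [m]. *)
rewrite big_split /= addnA IHmS.
case: i {IHmS} => [|i].
  under eq_bigr => k _ do rewrite bin0 -(bin0 k).
  by rewrite IHm // !bin0 !mul1n !subn0 expnS mul2n addnn.
under eq_bigr => k _ do rewrite binS mulnDr.
rewrite big_split /= !IHm // binS subSS addnA addnn mulnDl; congr (_ + _)%N.
(* Doubling [2 ^ (m - i.+1)] gives [2 ^ (m - i)] only if [i < m], as subtraction truncates;
   otherwise ['C(m, i.+1) = 0]. *)
have [ltim|leim] := ltnP i m; last by rewrite bin_small.
by rewrite -muln2 -mulnA -expnSr -subSn.
Qed.

Theorem theorem23 (R : realType) (j n : nat) (s sigma : nat -> R[i])
  (hjn : (j <= n)%N) (hpair : binomial_pair1 s sigma) :
  \sum_(0 <= k < n.+1) (-1) ^+ k * 'C(n - j, k)%:R * 2 ^+ (n - k) * s k =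
  2 ^+ j * \sum_(0 <= k < n.+1) 'C(n - j, k)%:R * sigma k.
Proof.
(* A range independent of [k], padded with zero terms, lets the two sums be exchanged. *)
have sigmaE k : (k < n.+1)%N ->
    sigma k = \sum_(0 <= i < n.+1) (-1) ^+ i * 'C(k, i)%:R * s i.
  move=> ltkn; rewrite hpair [RHS](big_cat_nat (n := k.+1)) //=.
  rewrite [X in _ + X]big_nat_cond [X in _ + X]big1 ?addr0 // => i.
  by rewrite andbT => /andP[ltki _]; rewrite bin_small // mulr0 mul0r.
under [in RHS]eq_big_nat => k /andP[_ ltkn] do rewrite sigmaE // big_distrr /=.
rewrite exchange_big big_distrr /=; apply: eq_bigr => i _.
transitivity (2 ^+ j * ((-1) ^+ i * s i *
    (\sum_(0 <= k < n.+1) 'C(n - j, k) * 'C(k, i))%N%:R)); last first.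
  congr (_ * _); rewrite natr_sum big_distrr /=; apply: eq_bigr => k _.
  by rewrite natrM; ring.
rewrite sum_bin_mul_bin ?ltnS ?leq_subr // natrM natrX.
(* For [i > n - j] both sides vanish with ['C(n - j, i)]. *)
have [leim|ltmi] := leqP i (n - j); last by rewrite bin_small //; ring.
have -> : (n - i = j + (n - j - i))%N by rewrite addnBA // subnKC.
by rewrite exprD; ring.
Qed.
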